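(* Let $p$ be a proper element of $L$ and let $n\geqslant 2$ be an integer. Consider the following statements: (a) $p$ is a $\delta$-primary element of $L$. (b) $p$ is a $\phi_0$-$\delta$-primary element of $L$. (c) $p$ is a $\phi_\omega$-$\delta$-primary element of $L$. (d) $p$ is a $\phi_{n+1}$-$\delta$-primary element of $L$. (e) $p$ is a $\phi_n$-$\delta$-primary element of $L$. (f) $p$ is a $\phi_2$-$\delta$-primary element of $L$. Then $(a)\Rightarrow(b)\Rightarrow(c)\Rightarrow(d)\Rightarrow(e)\Rightarrow(f)$.
   Context: A multiplicative lattice is a complete lattice (least element $0$, greatest element $1$) with a commutative, associative multiplication that distributes over arbitrary joins and for which $1$ is the identity. An element $a$ is compact if $a\leqslant \bigvee X$ with $X\subseteq L$ implies $a\leqslant a_1\vee\dots\vee a_n$ for finitely many $a_i\in X$; $L$ is compactly generated if every element is a join of compact elements. Standing assumptions: $L$ is a compactly generated multiplicative lattice in which $1$ is compact and every finite product of compact elements is compact; $\delta:L\to L$ is an expansion function, i.e. $a\leqslant\delta(a)$ for all $a$, and $a\leqslant b$ implies $\delta(a)\leqslant\delta(b)$. An element $p$ is proper if $p<1$. A proper element $p$ is $\delta$-primary if for all $a,b\in L$, $ab\leqslant p$ implies $a\leqslant p$ or $b\leqslant\delta(p)$. For a function $\phi:L\to L$, a proper element $p\in L$ is $\phi$-$\delta$-primary if for all $a,b\in L$, $ab\leqslant p$ and $ab\not\leqslant\phi(p)$ implies either $a\leqslant p$ or $b\leqslant\delta(p)$. The special functions are $\phi_0(p)=0$, $\phi_n(p)=p^n$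 for $n\geqslant 2$, and $\phi_\omega(p)=\bigwedge_{i=1}^{\infty}p^i$. *)

(* Defs.v *)
From HB Require Import structures.
From mathcomp Require Import all_boot all_order.
From mathcomp Require Import boolp classical_sets.

Set Implicit Arguments.
Unset Strict Implicit.
Unset Printing Implicit Defensive.

Import Order.Theory.

Local Open Scope classical_set_scope.
Local Open Scope order_scope.

(* [supremum \bot X] and [infimum \top X] are total: they return the default
   value on the empty set, which is the correct empty join or meet, and the
   least upper or greatest lower bound of X otherwise, provided it exists
   (see [supremums_neq0] below). *)
Definition bigjoin d (L : tbPOrderType d) (X : set L) : L := supremum \bot X.
Definition bigmeet d (L : tbPOrderType d) (X : set L) : L := infimum \top X.

(* A partial order in which every subset has a least upper bound is a complete
   lattice; [Order.TBLattice] already provides the two bounds and the binary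
   operations, so only arbitrary suprema have to be required. *)
HB.mixin Record isMultLattice d L of Order.TBLattice d L := {
  supremums_neq0 : forall X : set L, supremums X !=set0;
  mulL : L -> L -> L;
  mulLA : associative mulL;
  mulLC : commutative mulL;
  mul1L : left_id \top mulL;
  mulL_joinr : forall (a : L) (X : set L),
    mulL a (bigjoin X) = bigjoin [set mulL a x | x in X]
}.

#[short(type="multLatticeType")]
HB.structure Definition MultLattice d :=
  { L of isMultLattice d L & Order.TBLattice d L }.

HB.instance Definition _ d (L : multLatticeType d) :=
  Monoid.isComLaw.Build L \top (@mulL d L) (@mulLA d L) (@mulLC d L)
    (@mul1L d L).

Notation "a ** b" := (mulL a b) (at level 40, left associativity) : order_scope.

Definition expL d (L : multLatticeType d) (a : L) (n : nat) : L :=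
  \big[@mulL d L / \top]_(i < n) a.

(* The finite subfamily may be empty, so that \bot is compact. *)
Definition compactL d (L : tbLatticeType d) (a : L) : Prop :=
  forall X : set L, a <= bigjoin X ->
    exists2 s : seq L, (forall x, x \in s -> X x) & a <= \join_(x <- s) x.

Definition compactly_generated d (L : tbLatticeType d) : Prop :=
  forall a : L, exists2 X : set L,
    (forall x, X x -> compactL x) & a = bigjoin X.

Definition compact_prod_closed d (L : multLatticeType d) : Prop :=
  forall s : seq L, (forall x, x \in s -> compactL x) ->
    compactL (\big[@mulL d L / \top]_(x <- s) x).

Definition expansion d (L : porderType d) (delta : L -> L) : Prop :=
  (forall a, a <= delta a) /\ (forall a b, a <= b -> delta a <= delta b).

Definition properL d (L : tPOrderType d) (p : L) : Prop := p < \top.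

Definition delta_primary d (L : multLatticeType d) (delta : L -> L) (p : L) :
    Prop :=
  properL p /\ forall a b : L, a ** b <= p -> a <= p \/ b <= delta p.

Definition phi_delta_primary d (L : multLatticeType d) (phi delta : L -> L)
    (p : L) : Prop :=
  properL p /\ forall a b : L, a ** b <= p -> ~ (a ** b <= phi p) ->
    a <= p \/ b <= delta p.

Definition phi_zero d (L : multLatticeType d) (p : L) : L := \bot.

(* Used only for n >= 2. *)
Definition phi_pow d (L : multLatticeType d) (n : nat) (p : L) : L := expL p n.

Definition phi_omega d (L : multLatticeType d) (p : L) : L :=
  bigmeet [set expL p i | i in [set i : nat | (1 <= i)%N]].

(* Main.v *)
Require Import Defs.
From mathcomp Require Import all_boot all_order.
From mathcomp Require Import classical_sets.

Set Implicit Arguments.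
Unset Strict Implicit.
Unset Printing Implicit Defensive.

Import Order.Theory.

Local Open Scope classical_set_scope.
Local Open Scope order_scope.

(** The value [phi p] only serves to excuse products: the condition at a pair
    [a], [b] is void as soon as [a ** b <= phi p].  Enlarging [phi p] therefore
    weakens the notion ([phi_delta_primaryW]), and a delta-primary element is
    phi-delta-primary for every [phi].  All the implications then follow from
    the chain

      0 <= /\_(i >= 1) p^i <= p^(n+1) <= p^n <= p^2.

    Here 0 is the least element, the meet of the powers of [p] lies below each
    of them, and powers decrease because a product lies below each of its
    factors ([mulL_lel]). *)

Lemma le_bigjoin d (L : multLatticeType d) (X : set L) (x : L) :
  X x -> x <= bigjoin X.
Proof.
move=> Xx; rewrite /bigjoin /supremum.
case: ifPn => [/eqP X0|_]; first by move: Xx; rewrite X0.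
have [s sX] := supremums_neq0 X.
by case: xgetP => [y _ [yX _]|/(_ s)/(_ sX)//]; exact: yX.
Qed.

(** As in any complete join-semilattice, the greatest lower bound of [X] is
    obtained as the least upper bound of the lower bounds of [X]. *)
Lemma infimums_neq0 d (L : multLatticeType d) (X : set L) : infimums X !=set0.
Proof.
have [m [ubm lbm]] := supremums_neq0 (lbound X).
by exists m; split=> // x Xx; apply: lbm => y; apply.
Qed.

Lemma bigmeet_le d (L : multLatticeType d) (X : set L) (x : L) :
  X x -> bigmeet X <= x.
Proof.
move=> Xx; rewrite /bigmeet /infimum.
case: ifPn => [/eqP X0|_]; first by move: Xx; rewrite X0.
have [m mX] := infimums_neq0 X.
by case: xgetP => [y _ [yX _]|/(_ m)/(_ mX)//]; exact: yX.
Qed.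

(** Distributing [b] over the join of [a] and [\top], which is [\top], exhibits
    [b ** a] as one of the terms of a join equal to [b ** \top = b]. *)
Lemma mulL_lel d (L : multLatticeType d) (a b : L) : a ** b <= b.
Proof.
have join1 : bigjoin [set a; \top] = \top :> L.
  by apply/le_anti; rewrite lex1 le_bigjoin //; right.
rewrite -[leRHS]mul1L mulLC [leRHS]mulLC -join1 mulL_joinr.
by apply: le_bigjoin; exists a => //; left.
Qed.

Lemma expLS d (L : multLatticeType d) (p : L) (n : nat) :
  expL p n.+1 = p ** expL p n.
Proof. by rewrite /expL big_ord_recl. Qed.

Lemma expL_antitone d (L : multLatticeType d) (p : L) (m n : nat) :
  (m <= n)%N -> expL p n <= expL p m.
Proof.
move=> /subnK <-; elim: (n - m)%N => [|k IHk] //.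
by rewrite addSn expLS (le_trans (mulL_lel _ _)).
Qed.

Lemma phi_omega_le_expL d (L : multLatticeType d) (p : L) (n : nat) :
  (1 <= n)%N -> phi_omega p <= expL p n.
Proof. by move=> n_gt0; apply: bigmeet_le; exists n. Qed.

Lemma delta_primary_phi d (L : multLatticeType d) (phi delta : L -> L) (p : L) :
  delta_primary delta p -> phi_delta_primary phi delta p.
Proof. by move=> [p1 prim_p]; split=> // a b abp _; exact: prim_p. Qed.

Lemma phi_delta_primaryW d (L : multLatticeType d) (phi psi delta : L -> L)
    (p : L) :
  phi p <= psi p -> phi_delta_primary phi delta p ->
  phi_delta_primary psi delta p.
Proof.
move=> le_phi_psi [p1 prim_p]; split=> // a b abp abNpsi.
by apply: prim_p => // abphi; apply: abNpsi; exact: le_trans le_phi_psi.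
Qed.

Theorem theorem2p13 (d : Order.disp_t) (L : multLatticeType d)
    (L_compactly_generated : compactly_generated L)
    (top_compact : compactL (\top%O : L))
    (prod_compact : compact_prod_closed L)
    (delta : L -> L) (delta_expansion : expansion delta)
    (p : L) (p_proper : properL p) (n : nat) (n_ge2 : (2 <= n)%N) :
  (delta_primary delta p ->
     phi_delta_primary (@phi_zero d L) delta p) /\
  (phi_delta_primary (@phi_zero d L) delta p ->
     phi_delta_primary (@phi_omega d L) delta p) /\
  (phi_delta_primary (@phi_omega d L) delta p ->
     phi_delta_primary (phi_pow n.+1) delta p) /\
  (phi_delta_primary (phi_pow n.+1) delta p ->
     phi_delta_primary (phi_pow n) delta p) /\
  (phi_delta_primary (phi_pow n) delta p ->
     phi_delta_primary (phi_pow 2) delta p).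
Proof.
split; first exact: delta_primary_phi.
split; first by apply: phi_delta_primaryW; exact: le0x.
split; first by apply: phi_delta_primaryW; exact: phi_omega_le_expL.
by split; apply: phi_delta_primaryW; apply: expL_antitone.
Qed.
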